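(* Let $\mathbb F$ be an algebraically closed field of characteristic $0$, let $k \geq 2$ be an integer, and let $n\in\{3,4\}$. Let $A_1 \in \mathrm{GL}_n(\mathbb F)$ and $A_2 \in M_n(\mathbb F)$, and consider the map $\omega : M_n(\mathbb F) \times M_n(\mathbb F) \rightarrow M_n(\mathbb F)$ given by $$\omega(x_1, x_2) = A_1 x_1^k + A_2 x_2^k.$$ Then $\omega$ is surjective on $M_n(\mathbb F)$ if and only if $n > k(r_0 - 1)$, where $r_0=\dim\ker(A_2)$ is the nullity of $A_2$.
   Context: $M_n(\mathbb F)$ denotes the algebra of $n\times n$ matrices over $\mathbb F$, and $\mathrm{GL}_n(\mathbb F)$ the group of invertible ones. *)

(* Defs.v *)
From mathcomp Require Import all_boot all_order all_algebra.
Set Implicit Arguments.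
Unset Strict Implicit.
Unset Printing Implicit Defensive.
Import GRing.Theory.
Local Open Scope ring_scope.

(* [kermx] is the left (row) kernel; the rows of [kermx A^T] span the
   transposes of the column vectors v with A *m v = 0. *)
Definition nullity (F : fieldType) (n : nat) (A : 'M[F]_n) : nat :=
  \rank (kermx A^T).

Definition omega (F : fieldType) (n k : nat) (A1 A2 : 'M[F]_n)
    (x : 'M[F]_n * 'M[F]_n) : 'M[F]_n :=
  A1 *m x.1 ^+ k + A2 *m x.2 ^+ k.

(* Main.v *)
Require Import Defs.
From mathcomp Require Import all_boot all_order all_algebra.
Import Order.TTheory GRing.Theory Num.Theory.
Set Implicit Arguments.
Unset Strict Implicit.
Local Open Scope ring_scope.

(* Multiplying by A1^-1, the equation becomes x1^k + A x2^k = Y. Row vectors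
   w in the left kernel W of A satisfy w x1^k = w Y, so Y prescribes x1^k on W.
   If Y acts on W as a nilpotent Jordan block of size r0, then x1 must have a
   nilpotent chain of length k (r0 - 1) + 1, whence k (r0 - 1) < n. Conversely
   it suffices to find a k-th power B agreeing with Y on W such that Y - B has
   the rank of A, since then Y - B = A C with C invertible, and invertible
   matrices have k-th roots. If W contains no chain w -> w Y -> 0 with w Y in W
   nonzero, B can be taken with ker B and im B independent, hence a k-th power.
   Such a chain forces r0 >= 2, so for n <= 4 the inequality gives r0 = 2 and k
   < n, and B can be taken of rank 1 and square zero. *)

(** * Matrix roots obtained as polynomials in the matrix *)

Lemma closed_field_rootX (F : closedFieldType) (k : nat) (a : F) :
  (0 < k)%N -> exists b : F, b ^+ k = a.
Proof.
move=> k_gt0; have [b bE] := solve_monicpoly (fun i => a *+ (i == 0%N)) k_gt0.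
exists b; rewrite bE; case: k k_gt0 {bE} => // k _.
rewrite big_ord_recl mulr1 big1 ?addr0 // => i _.
by rewrite /= mulr0n mul0r.
Qed.

(* Hensel lifting at a repeated root (where a <> 0 is needed) and Chinese
   remaindering at a new root are both the correction q + c p, which multiplies
   the modulus p by one more linear factor. *)
Lemma poly_rootX_mod (F : closedFieldType) (k : nat) (s : seq F) :
    (0 < k)%N -> k%:R != 0 :> F -> (count_mem 0%R s <= 1)%N ->
  exists q : {poly F}, \prod_(a <- s) ('X - a%:P) %| q ^+ k - 'X.
Proof.
move=> k_gt0 k_neq0; elim: s => [_|a s IHs] /=.
  by exists 0; rewrite big_nil dvd1p.
move=> s0; have [|q] := IHs; first exact: leq_trans (leq_addl _ _) s0.
rewrite big_cons; set p := \prod_(a <- s) _ => /dvdpP[r qkE].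
(* [c p S(c)] is the change in [q ^+ k], so it remains to choose a constant [c] making the new
   quotient [r + c S(c)] vanish at [a]. *)
pose S c := \sum_(i < k) (q + c%:P * p) ^+ (k.-1 - i) * q ^+ i.
have stepE c : (q + c%:P * p) ^+ k - 'X = (r + c%:P * S c) * p.
  rewrite mulrDl -qkE -[X in X - _](subrK (q ^+ k)) subrXX -/(S c).
  by rewrite [q + _]addrC addrK -addrA addrC mulrAC.
suff [c rc]: exists c, root (r + c%:P * S c) a.
  exists (q + c%:P * p); rewrite stepE dvdp_mul2r ?dvdp_XsubCl //.
  by rewrite /p monic_neq0 // monic_prod_XsubC.
have [pa0|pa_neq0] := eqVneq p.[a] 0; last first.
  have [b bE] := closed_field_rootX a k_gt0.
  exists ((b - q.[a]) / p.[a]); rewrite /root -(mulIr_eq0 _ (mulIf pa_neq0)).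
  rewrite -hornerM -stepE !hornerE divfK //.
  by rewrite [q.[a] + _]addrC subrK bE subrr.
have a_neq0 : a != 0.
  apply: contraTneq s0 => a0; rewrite a0 eqxx -ltnNge ltnS -has_count.
  by rewrite has_pred1 -a0 -root_prod_XsubC /root pa0.
have qaE : q.[a] ^+ k = a.
  by have /eqP := congr1 (horner^~ a) qkE; rewrite /= !hornerE pa0 mulr0
    subr_eq0 => /eqP.
have qa_neq0 : q.[a] != 0.
  by apply: contraNneq a_neq0 => qa0; rewrite -qaE qa0 expr0n eqn0Ngt k_gt0.
pose d := q.[a] ^+ k.-1 *+ k.
have d_neq0 : d != 0 by rewrite /d -mulr_natr mulf_neq0 // expf_neq0.
(* Since [p] vanishes at [a], [S c] takes the value [d] there whatever [c] is: the equation for [c]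
   is linear. *)
exists (- r.[a] / d); rewrite /root !hornerE horner_sum.
rewrite (eq_bigr (fun _ => q.[a] ^+ k.-1)) => [|i _].
  by rewrite sumr_const card_ord divfK // subrr.
rewrite !hornerE pa0 mulr0 addr0 -exprD subnK //.
by rewrite -ltnS prednK.
Qed.

Lemma mulmx_exp_ker (F : fieldType) (m n : nat) (M : 'M[F]_(m, n)) (B :
  'M[F]_n) (j : nat) :
    (forall v : 'rV_n, v *m B *m B = 0 -> v *m B = 0) ->
  M *m B ^+ j = 0 -> M *m B = 0.
Proof.
move=> kerB; elim: j M => [|j IHj] M; first by rewrite expr0 mulmx1 => ->;
  rewrite mul0mx.
rewrite exprS mulmxA => /IHj MBB0; apply/row_matrixP => i.
by rewrite row0 row_mul kerB // -!row_mul MBB0 row0.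
Qed.

(** The kernel condition makes 0 at most a simple root of the minimal polynomial, so [B] is killed
    by ['X] times a product of factors with nonzero roots. Modulo that product ['X] is a k-th power
    [q ^+ k], and [q] evaluated at [B] is the root. *)
Lemma mx_rootX (F : closedFieldType) (k n : nat) (B : 'M[F]_n.+1) :
    (0 < k)%N -> k%:R != 0 :> F ->
    (forall v : 'rV_n.+1, v *m B *m B = 0 -> v *m B = 0) ->
  exists C : 'M_n.+1, C ^+ k = B.
Proof.
move=> k_gt0 k_neq0 kerB.
have [m [g]] := multiplicity_XsubC (char_poly B) 0.
rewrite monic_neq0 ?char_poly_monic //= subr0 => g0 gE.
have gB0 : horner_mx B g *m B = 0.
  apply: (@mulmx_exp_ker _ _ _ _ _ m kerB).
  have := Cayley_Hamilton B; rewrite gE rmorphM rmorphXn /= horner_mx_X //.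

have [s sE] := closed_field_poly_normal g.
have lg_neq0 : lead_coef g != 0.
  by rewrite lead_coef_eq0; apply: contraNneq g0 => ->; rewrite root0.
have pB0 : horner_mx B (\prod_(a <- s) ('X - a%:P)) *m B = 0.
  apply/eqP; move/eqP: gB0.
  by rewrite sE linearZ /= -scalemxAl scaler_eq0 (negPf lg_neq0).
have [|q /dvdpP[r qE]] := poly_rootX_mod (s := 0 :: s) k_gt0 k_neq0.
  rewrite /= eqxx leq_eqVlt eqSS -leqn0 leqNgt -has_count has_pred1.
  by rewrite -root_prod_XsubC -(rootZ _ _ lg_neq0) -sE g0.
exists (horner_mx B q); apply/eqP; rewrite -subr_eq0.
have /eqP := congr1 (horner_mx B) qE.
rewrite rmorphB rmorphXn rmorphM /= horner_mx_X => /eqP ->.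
by rewrite big_cons polyC0 subr0 ['X * _]mulrC rmorphM /= horner_mx_X -!mulmxE
  pB0 mulmx0.
Qed.

(** * Nilpotent Jordan blocks *)

(** For [k < n], a nilpotent Jordan block of size [k.+1] padded with zeros: on row vectors, e_i goes
    to e_(i-1) for 0 < i <= k, and the other e_i go to 0. *)
Definition trunc_shift (R : pzRingType) (n k : nat) : 'M[R]_n :=
  \matrix_(i, j) ((i == j.+1 :> nat) && (i <= k)%N)%:R.

Lemma trunc_shiftX (R : pzRingType) (n k m : nat) :
  trunc_shift R n k ^+ m.+1
    = \matrix_(i, j) ((i == j + m.+1 :> nat)%N && (i <= k)%N)%:R.
Proof.
elim: m => [|m IHm]; first by apply/matrixP => i j; rewrite !mxE addn1.
rewrite exprS {}IHm; apply/matrixP => i j; rewrite !mxE.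
have [/andP[/eqP iE ik]|iN] := boolP (_ && (i <= k)%N).
  have ltl : (j + m.+1 < n)%N.
    by apply: leq_ltn_trans (ltn_ord i); rewrite iE leq_add2l.
  rewrite (bigD1 (Ordinal ltl)) //= !mxE /= iE addnS eqxx /= big1 => [|l lN].
    rewrite -addnS -iE ik !eqxx addr0 (leq_trans _ ik) ?mulr1 //.
    by rewrite iE !addnS.
  rewrite !mxE; case: eqP => [lE|_]; last by rewrite mul0r.
  by case/eqP: lN; apply/val_inj => /=; move: lE; rewrite iE !addnS => -[].
rewrite big1 // => l _; rewrite !mxE.
have [/andP[/eqP lE lk]|_] := boolP (_ && (l <= k)%N); last by rewrite mulr0.
have [/andP[/eqP iE ik]|_] := boolP (_ && _); last by rewrite mul0r.
by move: iN; rewrite ik iE lE !addnS eqxx.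
Qed.

(* Bezout between X^m and the part of char_poly C prime to X. *)
Lemma mulmx_exp_nilpotent (F : fieldType) (n m : nat) (w : 'rV[F]_n.+1)
    (C : 'M_n.+1) :
  w *m C ^+ m = 0 -> w *m C ^+ n.+1 = 0.
Proof.
move=> wCm0; have [j [g]] := multiplicity_XsubC (char_poly C) 0.
rewrite monic_neq0 ?char_poly_monic //= subr0 => g0 gE.
have le_jn : (j <= n.+1)%N.
  have g_neq0 : g != 0 by apply: contraNneq g0 => ->; rewrite root0.
  have := congr1 (fun p : {poly F} => size p) gE.
  rewrite size_char_poly size_Mmonic ?monicXn // size_polyXn addnS /= => nE.
  by rewrite -ltnS nE -[X in (X < _)%N]add0n ltn_add2r size_poly_gt0.
have /Bezout_eq1_coprimepP[[u v] /= uv1] : coprimep g ('X ^+ m).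
  by rewrite coprimep_expr // -['X]subr0 coprimep_XsubC.
suff wCj0 : w *m C ^+ j = 0.
  by rewrite -[X in _ *m _ ^+ X](subnKC le_jn) exprD mulmxA wCj0 mul0mx.
(* Multiplying the Bezout identity by ['X^j] completes [g] to [char_poly C], which vanishes at
   [C]. *)
have uvjE : u * char_poly C + 'X^m * (v * 'X^j) = 'X^j.
  by rewrite ['X^m * _]mulrCA gE [v * _]mulrA mulrA -mulrDl uv1 mul1r.
have -> : C ^+ j = horner_mx C 'X^j by rewrite rmorphXn /= horner_mx_X.
rewrite -uvjE rmorphD !rmorphM /= Cayley_Hamilton.
rewrite mulr0 add0r !rmorphXn /= horner_mx_X.
by rewrite mulmxA wCm0 mul0mx.
Qed.

(** * Changes of basis, invertible factors, and roots in rank one *)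

(** The transposes both have full row space, and equal row spaces differ by an invertible left
    factor. *)
Lemma row_free_transport (F : fieldType) (r n : nat) (X Z : 'M[F]_(r, n)) :
  row_free X -> row_free Z -> exists2 P, P \in unitmx & X *m P = Z.
Proof.
move=> Xfree Zfree; have tr_full (M : 'M[F]_(r, n)) : row_free M -> row_full
  M^T.
  by rewrite /row_full mxrank_tr.
have : (Z^T == X^T)%MS by rewrite !submx_full ?tr_full.
move=> /eqmxMunitP[P Punit ZE]; exists P^T; first by rewrite unitmx_tr.
by apply: trmx_inj; rewrite trmx_mul trmxK ZE.
Qed.

(** Multiplying a linear relation by [M] removes [X1], hence kills the coefficients of [X2] first.
    This gives the independence of Jordan chains. *)
Lemma row_free_col_mx (F : fieldType) (r1 r2 n p : nat) (X1 : 'M[F]_(r1, n))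
    (X2 : 'M_(r2, n)) (M : 'M_(n, p)) :
  row_free X1 -> X1 *m M = 0 -> row_free (X2 *m M) -> row_free (col_mx X1 X2).
Proof.
move=> X1free X1M X2Mfree; apply: inj_row_free => v.
rewrite -[v]hsubmxK mul_row_col; set a := lsubmx v; set b := rsubmx v => abX.
have b0 : b = 0.
  apply: (row_free_inj X2Mfree); rewrite mul0mx mulmxA.
  by have := congr1 (mulmx^~ M) abX; rewrite /= mulmxDl -mulmxA X1M mulmx0
    add0r mul0mx.
have a0 : a = 0.
  by apply: (row_free_inj X1free); move: abX; rewrite b0 !mul0mx addr0.
by rewrite a0 b0 row_mx0.
Qed.

Lemma row_free_rV (F : fieldType) (n : nat) (v : 'rV[F]_n) :
  row_free v = (v != 0).
Proof. by rewrite /row_free rank_rV; case: (v != 0). Qed.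

(** Vanishing on the left kernel of [A] puts the column space of [M] inside that of [A]; the rank
    bound makes them equal. *)
Lemma mulmx_unit_factor (F : fieldType) (n : nat) (A M : 'M[F]_n) :
    kermx A *m M = 0 -> (\rank A <= \rank M)%N ->
  exists2 C, C \in unitmx & M = A *m C.
Proof.
move=> kerM le_rank.
have le_r := rank_leq_row A.
pose L := col_ebase A; have Lunit : L \in unitmx := col_ebase_unit A.
have : (copid_mx (\rank A) *m invmx L <= kermx A)%MS.
  apply/sub_kermxP; rewrite -[X in _ *m X = _]mulmx_ebase -/L !mulmxA mulmxKV
    //.
  by rewrite mul_copid_mx_pid ?mul0mx.
move=> /submxP[D DE].
have LM : invmx L *m M = pid_mx (\rank A) *m (invmx L *m M).
  apply/eqP; rewrite -subr_eq0 -[X in X - _]mul1mx -mulmxBl mulmxA DE.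
  by rewrite -mulmxA kerM mulmx0.
have ME : M = A *m (invmx (row_ebase A) *m pid_mx (\rank A) *m (invmx L *m M)).
  rewrite -{1}[A]mulmx_ebase -/L !mulmxA mulmxK ?row_ebase_unit //.
  by rewrite -[L *m _ *m _]mulmxA pid_mx_id // -!mulmxA -LM mulKVmx.
have leM : (M^T <= A^T)%MS by rewrite ME trmx_mul submxMl.
have /eqmxMunitP[P Punit PE] : (M^T == A^T)%MS.
  by rewrite -(geq_leqif (mxrank_leqif_eq leM)) !mxrank_tr.
exists P^T; first by rewrite unitmx_tr.
by apply: trmx_inj; rewrite PE trmx_mul trmxK.
Qed.

Lemma conjmx_expX (F : fieldType) (n k : nat) (P J : 'M[F]_n) :
  P \in unitmx -> (invmx P *m J *m P) ^+ k = invmx P *m J ^+ k *m P.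
Proof.
move=> Punit; elim: k => [|k IHk]; first by rewrite !expr0 mulmx1 mulVmx.
by rewrite !exprS IHk -!mulmxE !mulmxA mulmxK.
Qed.

(* A square-zero matrix of rank 1 is the k-th power of a nilpotent Jordan block
   of size k + 1, padded with zeros. *)
Lemma rank1_rootX (F : fieldType) (n k : nat) (f : 'cV[F]_n.+1)
    (w : 'rV_n.+1) :
  w *m f = 0 -> (0 < k <= n)%N -> exists C : 'M_n.+1, C ^+ k = f *m w.
Proof.
move=> wf0 /andP[k_gt0 le_kn].
have expr0k : (0 : 'M[F]_n.+1) ^+ k = 0 by rewrite expr0n eqn0Ngt k_gt0.
have [->|f_neq0] := eqVneq f 0; first by exists 0; rewrite expr0k mul0mx.
have [->|w_neq0] := eqVneq w 0; first by exists 0; rewrite expr0k mulmx0.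
have [x xf1] : exists x : 'rV_n.+1, x *m f = 1%:M.
  have : row_free f^T by rewrite row_free_rV trmx_eq0.
  move=> /row_freeP[B fB]; exists B^T.
  by apply: trmx_inj; rewrite trmx_mul trmxK fB trmx1.
pose o : 'I_n.+1 := inord k; have oE : o = k :> nat by rewrite inordK.
have o_neq0 : o != 0 by rewrite -val_eqE /= oE -lt0n.
pose e i : 'rV[F]_n.+1 := delta_mx 0 i; pose ek : 'cV[F]_n.+1 := delta_mx o 0.
have e_neq0 i : e i != 0.
  by apply/eqP => /matrixP/(_ 0 i)/eqP; rewrite !mxE !eqxx oner_eq0.
have eek i : e i *m ek = (i == o)%:R%:M.
  rewrite mul_delta_mx_cond; apply/matrixP => a b.
  by rewrite !ord1 !mxE eqxx; case: (i == o); rewrite ?mulr1n ?mxE.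
have Xfree : row_free (col_mx w x).
  apply: (@row_free_col_mx _ _ _ _ _ _ _ f); rewrite ?row_free_rV // xf1.
  exact: oner_neq0.
have Zfree : row_free (col_mx (e 0) (e o)).
  apply: (@row_free_col_mx _ _ _ _ _ _ _ ek); rewrite ?row_free_rV ?eek ?eqxx
    //.
  - by rewrite eq_sym (negPf o_neq0) raddf0.
  - exact: oner_neq0.
have [P Punit] := row_free_transport Zfree Xfree.
rewrite mul_col_mx => /eq_col_mx[e0P eoP].
(* [P] already sends e_0 to [w] and e_k to [x]; [h] is its error on [f]. As entries 0 and k of [h]
   vanish, the transvection [1 - h e_k] is invertible, fixes e_0 and sends [P *m f] to [ek]. *)
pose h := P *m f - ek.
have eoh : e o *m h = 0.
  by rewrite mulmxBr mulmxA eoP xf1 eek eqxx subrr.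
have e0h : e 0 *m h = 0.
  by rewrite mulmxBr mulmxA e0P wf0 eek eq_sym (negPf o_neq0) raddf0 subrr.
have Pf : P *m f = h + ek by rewrite subrK.
clearbody h.
pose Q := (1%:M - h *m e o) *m P.
have Qunit : Q \in unitmx.
  rewrite unitmx_mul Punit andbT.
  suff /mulmx1_unit[] : (1%:M - h *m e o) *m (1%:M + h *m e o) = 1%:M by [].
  rewrite mulmxDr mulmx1 mulmxBl mul1mx [h *m _ *m _]mulmxA -[h *m e o *m
    h]mulmxA eoh.
  by rewrite mulmx0 mul0mx subr0 subrK.
have e0Q : e 0 *m Q = w.
  by rewrite mulmxA mulmxBr mulmx1 mulmxA e0h mul0mx subr0 e0P.
have Qf : Q *m f = ek.
  by rewrite /Q -mulmxA mulmxBl mul1mx -mulmxA (mulmxA (e o)) eoP xf1 mulmx1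
    Pf addrC addKr.
exists (invmx Q *m trunc_shift F n.+1 k *m Q); rewrite conjmx_expX //.
have -> : trunc_shift F n.+1 k ^+ k = ek *m e 0.
  rewrite -[X in _ ^+ X](prednK k_gt0) trunc_shiftX prednK // mul_delta_mx.
  apply/matrixP => i j; rewrite !mxE -!val_eqE /= oE.
  have [->|j_neq0] := eqVneq (j : nat) 0%N; last rewrite andbF.
    by rewrite add0n; have [->|] := eqVneq (i : nat) k; rewrite ?leqnn.
  have [iE|//] := eqVneq; case: (leqP i k) => //.
  by rewrite iE -[X in (_ <= X)%N]add0n leq_add2r leqn0 (negPf j_neq0).
by rewrite -mulmxA -mulmxA e0Q mulmxA -Qf mulKmx.
Qed.

(** * Sufficiency of the bound *)

(** Any nonzero [t] that is not an eigenvalue of [Y *m invmx P] works. At a root of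
    ['X * char_poly _ + 1] neither factor of the product can vanish. *)
Lemma subr_scale_unitmx (F : closedFieldType) (n : nat) (Y P : 'M[F]_n) :
  P \in unitmx -> exists2 t : F, t != 0 & Y - t *: P \in unitmx.
Proof.
move=> Punit; pose p := 'X * char_poly (Y *m invmx P) + 1.
have /closed_rootP[t] : size p != 1%N.
  rewrite size_polyDl ?size_poly1 mulrC size_mulX ?monic_neq0 ?char_poly_monic
    //.
    by rewrite size_char_poly.
  by rewrite size_char_poly.
rewrite /root !hornerE addr_eq0 => /eqP tE.
have : t * (char_poly (Y *m invmx P)).[t] != 0 by rewrite tE oppr_eq0 oner_eq0.
rewrite mulf_eq0 negb_or => /andP[t_neq0 pt_neq0]; exists t => //.
rewrite -row_free_unit; apply: inj_row_free => v.
rewrite mulmxBr -scalemxAr => /eqP; rewrite subr_eq0 => /eqP vE.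
apply/eqP; apply: contraNT pt_neq0 => v_neq0.
rewrite -/(root _ t) -eigenvalue_root_char; apply/eigenvalueP.
by exists v; rewrite // mulmxA vE -scalemxAl mulmxK.
Qed.

Lemma mx_rootX_unit (F : closedFieldType) (k n : nat) (B : 'M[F]_n.+1) :
    (0 < k)%N -> k%:R != 0 :> F -> B \in unitmx ->
  exists C : 'M_n.+1, C ^+ k = B.
Proof.
move=> k_gt0 k_neq0 Bunit; apply: mx_rootX => // v vBB.
by rewrite -[LHS](mulmxK Bunit) vBB mul0mx.
Qed.

Lemma mxrank_ker_compl (F : fieldType) (n : nat) (A : 'M[F]_n)
    (Q : 'M[F]_(n, \rank (kermx A))) (K : 'M[F]_(\rank (kermx A), n)) :
  (\rank A <= \rank (1%:M - Q *m K)%R)%N.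
Proof.
have := mxrank_add (1%:M - Q *m K) (Q *m K).
have := mulmx_max_rank Q K; rewrite [X in (_ <= X)%N]mxrank_ker.
rewrite subrK mxrank1; have := rank_leq_row A.
move: (\rank A) (\rank (_ - _)) (\rank (_ *m _)) => a b c an cn nbc.
by rewrite -(leq_add2r c) (leq_trans _ nbc) // -leq_subRL.
Qed.

(* The hypothesis says that Y has no Jordan chain w -> w Y -> 0 inside the left
   kernel W of A. Then [w |-> w Y] on a complement of W /\ ker Y in W and the
   identity on W /\ ker Y glue to an injection Z on W, extended to P. The first
   summand is Y on W and a generic multiple t P of P elsewhere. *)
Lemma waring_generic (F : closedFieldType) (k n : nat) (A Y : 'M[F]_n.+1) :
    (0 < k)%N -> k%:R != 0 :> F ->
    (forall w : 'rV_n.+1, w *m A = 0 -> w *m Y *m A = 0 ->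
       w *m Y *m Y = 0 -> w *m Y = 0) ->
  exists x1 x2 : 'M_n.+1, x1 ^+ k + A *m x2 ^+ k = Y.
Proof.
move=> k_gt0 k_neq0 chainY.
pose K := row_base (kermx A).
have Kfree : row_free K := row_base_free _.
have KA0 : K *m A = 0 by apply/sub_kermxP; rewrite eq_row_base.
have KE : (kermx A <= K)%MS by rewrite eq_row_base.
clearbody K; have [Q KQ] := row_freeP Kfree; pose N := K *m Y.
(* In the coordinates given by [K], [e] is an idempotent whose left kernel is W /\ ker Y. *)
pose e := N *m pinvmx N.
have eN : e *m N = N by rewrite mulmxKpV.
have ee : e *m e = e by rewrite mulmxA eN.
have ker_e (x : 'rV_(\rank (kermx A))) : x *m N = 0 -> x *m e = 0.
  by move=> xN0; rewrite /e mulmxA xN0 mul0mx.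
have NE : K *m Y = N by [].
clearbody e N.
pose Z := N + (1%:M - e) *m K.
have eZ : e *m Z = N.
  by rewrite mulmxDr eN mulmxA mulmxBr mulmx1 ee subrr mul0mx addr0.
have ceZ : (1%:M - e) *m Z = (1%:M - e) *m K.
  by rewrite mulmxBl mul1mx eZ addrC addKr.
have Zfree : row_free Z.
  apply: inj_row_free => x xZ0.
  have xNE : x *m N = - (x *m (1%:M - e) *m K).
    by apply/eqP; rewrite -addr_eq0 -mulmxA -mulmxDr xZ0.
  (* The vector [x e K] of W has image [x N] under [Y], which lies in W and is killed by [Y], so the
     chain hypothesis applies. *)
  have xN0 : x *m N = 0.
    have wYE : x *m e *m K *m Y = x *m N by rewrite -!mulmxA NE eN.
    rewrite -wYE; apply: chainY; first by rewrite -!mulmxA KA0 !mulmx0.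
      by rewrite wYE xNE mulNmx -!mulmxA KA0 !mulmx0 oppr0.
    rewrite wYE xNE mulNmx -!mulmxA NE mulmxBl mul1mx eN subrr.
    by rewrite mulmx0 oppr0.
  have xe0 := ker_e _ xN0.
  apply: (row_free_inj Kfree); apply/eqP; rewrite mul0mx -oppr_eq0.
  by move/eqP: xNE; rewrite xN0 mulmxBr mulmx1 xe0 subr0 eq_sym.
have [P Punit KP] := row_free_transport Kfree Zfree.
have [t t_neq0 Ytunit] := subr_scale_unitmx Y Punit.
pose D := Q *m e *m K + t *: (1%:M - Q *m K).
have DQ : D *m Q = Q *m e.
  rewrite mulmxDl -[_ *m K *m Q]mulmxA KQ mulmx1 -scalemxAl mulmxBl mul1mx.
  by rewrite -mulmxA KQ mulmx1 subrr scaler0 addr0.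
have YB : Y - D *m P = (1%:M - Q *m K) *m (Y - t *: P).
  rewrite /D [X in Y - X]mulmxDl -[_ *m K *m P]mulmxA KP -mulmxA eZ -NE mulmxA
    -scalemxAl.
  by rewrite mulmxBr -scalemxAr [in RHS]mulmxBl mul1mx opprD addrA.
have [x1 x1E] : exists C : 'M_n.+1, C ^+ k = D *m P.
  (* A vector [z = v D P] killed by [D P] lies in W /\ ker Y, where [P] is the identity; hence
     [z = v D], and its coordinates are both fixed and killed by [e]. *)
  apply: mx_rootX => // v; set z := v *m _ => zDP0.
  have zD0 : z *m D = 0 by rewrite -[LHS](mulmxK Punit) -[z *m D *m P]mulmxA
    zDP0 mul0mx.
  have zQe0 : z *m Q *m e = 0 by rewrite -mulmxA -DQ mulmxA zD0 mul0mx.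
  have zE : z = z *m Q *m K.
    apply/eqP; rewrite -subr_eq0 -[X in X - _]mulmx1 -mulmxA -mulmxBr.
    rewrite -(inj_eq (scalerI t_neq0)) scaler0 scalemxAr.
    by move: zD0; rewrite mulmxDr !mulmxA zQe0 mul0mx add0r => ->.
  have zcE : z *m Q *m (1%:M - e) = z *m Q by rewrite mulmxBr mulmx1 zQe0 subr0.
  have zPE : z *m P = z.
    by rewrite {1}zE -[LHS]mulmxA KP -zcE -[LHS]mulmxA ceZ mulmxA zcE -zE.
  have vDz : v *m D = z.
    by apply: (can_inj (mulmxK Punit)); rewrite zPE /z mulmxA.
  have vQe : v *m Q *m e = z *m Q by rewrite -mulmxA -DQ mulmxA vDz.
  by rewrite zE -vQe -ee mulmxA vQe zQe0 mul0mx.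
have [||C Cunit CE] := @mulmx_unit_factor F _ A (Y - D *m P).
- have /submxP[G GE] := KE.
  rewrite YB [LHS]mulmxA [X in X *m _ *m _]GE -[G *m K *m _]mulmxA.
  by rewrite [K *m _]mulmxBr mulmx1 (mulmxA K) KQ mul1mx subrr mulmx0 mul0mx.
- by rewrite YB mxrankMfree ?row_free_unit // mxrank_ker_compl.
have [x2 x2E] := mx_rootX_unit k_gt0 k_neq0 Cunit.
by exists x1, x2; rewrite x1E x2E -CE addrC subrK.
Qed.

(* With v = w Y, the first summand is f v for a column f with v f = 0 and
   w f = 1; f is chosen so that Y - f v has the rank of A. This fails only when
   Y has rank 1, and then Y = f v is itself a k-th power. *)
Lemma waring_jordan_chain (F : closedFieldType) (k n : nat) (A Y : 'M[F]_n.+1)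
    (w : 'rV_n.+1) :
    (0 < k <= n)%N -> k%:R != 0 :> F -> (n <= 3)%N ->
    (\rank (kermx A) <= 2)%N ->
    w *m A = 0 -> w *m Y *m A = 0 -> w *m Y *m Y = 0 -> w *m Y != 0 ->
  exists x1 x2 : 'M_n.+1, x1 ^+ k + A *m x2 ^+ k = Y.
Proof.
move=> k_bounds k_neq0 le_n3 rankK wA0.
have [v wYE] : exists v, w *m Y = v by exists (w *m Y).
rewrite !wYE => vA0 vY0 v_neq0.
have k_gt0 : (0 < k)%N by case/andP: k_bounds.
have vwfree : row_free (col_mx v w).
  by apply: (@row_free_col_mx _ _ _ _ _ _ _ Y); rewrite ?wYE ?row_free_rV.
have vwA0 : col_mx v w *m A = 0 by rewrite mul_col_mx vA0 wA0 col_mx0.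
have kerA : (kermx A <= col_mx v w)%MS.
  have vwK : (col_mx v w <= kermx A)%MS by apply/sub_kermxP.
  rewrite -(geq_leqif (mxrank_leqif_sup vwK)).
  by move: vwfree; rewrite /row_free => /eqP ->.
have rankA : (\rank A < n)%N.
  have := mulmx0_rank_max vwA0; move: vwfree; rewrite /row_free => /eqP ->.
  by rewrite add2n ltnS.
have rankYn : (\rank Y <= n)%N.
  by have := mulmx0_rank_max vY0; rewrite rank_rV v_neq0 add1n ltnS.
have rankY_gt0 : (0 < \rank Y)%N.
  by rewrite lt0n mxrank_eq0; apply: contraNneq v_neq0 => Y0; rewrite -wYE Y0
    mulmx0.
have ex_f : \rank Y = 1%N \/
    exists f : 'cV_n.+1,
      [/\ v *m f = 0, w *m f = 1%:M & (\rank A <= \rank (Y - f *m v)%R)%N].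
  have [|rankY_gt1] := leqP (\rank Y) 1.
    by left; apply/eqP; rewrite eqn_leq rankY_gt0 andbT.
  right; have [rankYE|rankYN] := eqVneq (\rank Y) n.
    (* When [Y] has corank one, any [f] with the two prescribed values works: subtracting [f v]
       costs at most one rank. *)
    have [g] := row_freeP vwfree; rewrite mul_col_mx scalar_mx_block.
    move=> /eq_col_mx[vg wg]; exists (g *m col_mx 0 1%:M).
    rewrite !mulmxA vg wg !mul_row_col !mulmx0 !mulmx1 !add0r; split=> //.
    rewrite -ltnS (leq_trans rankA) // -[X in (X <= _)%N]rankYE.
    rewrite -[X in \rank X](subrK (g *m col_mx 0 1%:M *m v)).
    apply: leq_trans (mxrank_add _ _) _.
    exact: leq_trans (leq_add (leqnn _) (mulmx_max_rank _ _)) (eq_leq (addn1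
      _)).
  (* Now ker Y has dimension at least 2, so [f] can vanish at [v] without vanishing on ker Y. This
     puts [v], hence [Y], in the row space of [Y - f v], so no rank is lost. *)
  pose K := row_base (kermx Y).
  have Kfree : row_free K := row_base_free _.
  have KY0 : K *m Y = 0 by apply/sub_kermxP; rewrite eq_row_base.
  have /submxP[c vE] : (v <= K)%MS by rewrite eq_row_base; apply/sub_kermxP.
  have dimK : (1 < \rank (kermx Y))%N.
    by rewrite mxrank_ker ltn_subRL addn1 ltnS ltn_neqAle rankYN.
  clearbody K.
  have [d cd0 d_neq0] : exists2 d : 'cV_(\rank (kermx Y)), c *m d = 0 & d != 0.
    have : kermx c^T != 0.
      rewrite -mxrank_eq0 mxrank_ker -lt0n subn_gt0.
      exact: leq_ltn_trans (rank_leq_col _) dimK.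
    case/rowV0Pn => x /sub_kermxP xc x_neq0; exists x^T; last by rewrite
      trmx_eq0.
    by apply: trmx_inj; rewrite trmx_mul trmxK xc trmx0.
  have [g] : exists g, col_mx K w *m g = 1%:M.
    by apply/row_freeP; apply: (@row_free_col_mx _ _ _ _ _ _ _ Y); rewrite
      ?wYE ?row_free_rV.
  rewrite mul_col_mx scalar_mx_block => /eq_col_mx[Kg wg].
  pose f := g *m col_mx d 1%:M.
  have Kf : K *m f = d.
    by rewrite /f mulmxA Kg mul_row_col mul1mx mul0mx addr0.
  exists f; split; first by rewrite vE -mulmxA Kf.
    by rewrite /f mulmxA wg mul_row_col mulmx1 mul0mx add0r.
  have vYf : (v <= Y - f *m v)%MS.
    have [i di_neq0] : exists i, d i 0 != 0.
      by case/cV0Pn: d_neq0 => i; exists i.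
    apply/submxP; exists (- (d i 0)^-1 *: row i K).
    rewrite -scalemxAl -row_mul mulmxBr KY0 mulmxA Kf sub0r raddfN /=.
    rewrite scalerN scaleNr opprK row_mul (_ : row i d = (d i 0)%:M).
      by rewrite mul_scalar_mx scalerA mulVf ?scale1r.
    by apply/rowP => l; rewrite !mxE ord1 eqxx.
  have YYf : (Y <= Y - f *m v)%MS.
    rewrite -[X in (X <= _)%MS](subrK (f *m v)) addmx_sub //.
    exact: submx_trans (submxMl _ _) vYf.
  (* The bound [n <= 3] enters here: rank A <= 2 <= rank Y. *)
  apply: leq_trans (mxrankS YYf); rewrite -ltnS (leq_trans rankA) //.
  exact: leq_trans le_n3 (rankY_gt1 : 2 < (\rank Y).+1)%N.
have [rankY1|[f [vf0 wf1 rank_f]]] := ex_f.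
  have /submxP[f YE] : (Y <= v)%MS.
    have sub : (v <= Y)%MS by rewrite -wYE submxMl.
    by rewrite -(geq_leqif (mxrank_leqif_sup sub)) rankY1 rank_rV v_neq0.
  have vf0 : v *m f = 0.
    by apply: (@row_free_inj _ _ _ _ v); rewrite ?row_free_rV // -mulmxA -YE
      vY0 mul0mx.
  have [x1 x1E] := rank1_rootX vf0 k_bounds.
  by exists x1, 0; rewrite x1E expr0n eqn0Ngt k_gt0 mulmx0 addr0 -YE.
have [x1 x1E] := rank1_rootX vf0 k_bounds.
have [|C Cunit CE] := mulmx_unit_factor _ rank_f.
  have /submxP[G ->] := kerA.
  by rewrite -mulmxA mul_col_mx !mulmxBr !mulmxA vf0 wf1 vY0 wYE mul0mx mul1mx
    !subrr col_mx0 mulmx0.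
have [x2 x2E] := mx_rootX_unit k_gt0 k_neq0 Cunit.
by exists x1, x2; rewrite x1E x2E -CE addrC subrK.
Qed.

(** * Necessity of the bound *)

(* Y acts as a Jordan block of size r + 1 on part of the left kernel of A, where
   it agrees with x1 ^+ k: the vector w generating this block satisfies
   w x1^(k r) <> 0 = w x1^(k (r + 1)). *)
Lemma waring_surj_bound (F : fieldType) (k n r : nat) (A : 'M[F]_n.+1) :
    (r < \rank (kermx A))%N ->
    (forall Y, exists x1 x2 : 'M_n.+1, x1 ^+ k + A *m x2 ^+ k = Y) ->
  (k * r <= n)%N.
Proof.
move=> lt_r surjA; rewrite leqNgt; apply/negP => lt_nkr.
have [K Kfree KA0] : exists2 K : 'M[F]_(r.+1, n.+1), row_free K & K *m A = 0.
  pose L := row_base (kermx A).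
  pose S : 'M[F]_(r.+1, \rank (kermx A)) := pid_mx r.+1.
  exists (S *m L); first by rewrite /row_free mxrankMfree ?row_base_free //
    rank_pid_mx.
  by rewrite -mulmxA (_ : L *m A = 0) ?mulmx0 //; apply/sub_kermxP; rewrite
    eq_row_base.
have [Q KQ] := row_freeP Kfree.
pose N := trunc_shift F r.+1 r.
have [x1 [x2 xE]] := surjA (Q *m N *m K).
have KB : K *m x1 ^+ k = N *m K.
  by have := congr1 (mulmx K) xE; rewrite mulmxDr !mulmxA KA0 mul0mx addr0 KQ
    mul1mx.
have KBX m : K *m x1 ^+ (k * m) = N ^+ m *m K.
  elim: m => [|m IHm]; first by rewrite muln0 !expr0 mulmx1 mul1mx.
  by rewrite mulnS exprD mulmxA KB -mulmxA IHm mulmxA exprS.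
pose w := row ord_max K.
have wX m : w *m x1 ^+ (k * m) = row ord_max (N ^+ m) *m K.
  by rewrite -!row_mul KBX.
(* Nilpotency at [w] takes at most [n.+1 <= k * r] steps, whereas the last row of [N ^+ r] is e_0,
   which is nonzero. *)
have wn0 : w *m x1 ^+ n.+1 = 0.
  apply: (@mulmx_exp_nilpotent _ _ (k * r.+1)); rewrite wX trunc_shiftX.
  apply/eqP; rewrite -(mul0mx _ K); apply/eqP; congr (_ *m _).
  apply/rowP => j; rewrite !mxE /=; case: eqP => //= rE.
  by have := leq_addl j r.+1; rewrite -rE ltnn.
have r_gt0 : (0 < r)%N by case: (r) lt_nkr => //; rewrite muln0.
have : row ord_max (N ^+ r) *m K = 0 *m K.
  by rewrite -wX -[X in _ ^+ X](subnKC lt_nkr) exprD mulmxA wn0 !mul0mx.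
move=> /(row_free_inj Kfree)/rowP/(_ ord0)/eqP.
rewrite -[X in _ ^+ X](prednK r_gt0) trunc_shiftX !mxE prednK //= eqxx leqnn.
by rewrite oner_eq0.
Qed.

(** * Reduction to an identity first coefficient, and the equivalence *)

Lemma rank_kermx_lmul_unit (F : fieldType) (n : nat) (P A : 'M[F]_n) :
  P \in unitmx -> \rank (kermx (P *m A)) = nullity A.
Proof.
move=> Punit; rewrite /nullity !mxrank_ker mxrank_tr; congr (_ - _)%N.
by rewrite eqmxMfull ?row_full_unit.
Qed.

Theorem theorem1p3 (F : closedFieldType) (charF0 : [pchar F] =i pred0)
    (k : nat) (hk : (2 <= k)%N) (n : nat) (hn : n = 3%N \/ n = 4%N)
    (A1 A2 : 'M[F]_n) (hA1 : A1 \in unitmx) :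
  (forall y : 'M[F]_n,
     exists x : 'M[F]_n * 'M[F]_n, omega k A1 A2 x = y)
  <-> k%:Z * ((nullity A2)%:Z - 1) < n%:Z.
Proof.
have k_gt0 : (0 < k)%N := ltnW hk.
have k_neq0 : k%:R != 0 :> F by rewrite (pcharf0P F).1 // -lt0n.
case: n hn A1 A2 hA1 => [|n] hn A1 A2 hA1; first by case: hn.
have {hn} le_n3 : (n <= 3)%N by case: hn => -[->].
pose A := invmx A1 *m A2.
have <- : \rank (kermx A) = nullity A2.
  by apply: rank_kermx_lmul_unit; rewrite unitmx_inv.
have omegaE : (forall y, exists x, omega k A1 A2 x = y) <->
    (forall Y, exists x1 x2 : 'M_n.+1, x1 ^+ k + A *m x2 ^+ k = Y).
  split=> surj Y.
    have [[x1 x2] xE] := surj (A1 *m Y); exists x1, x2.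
    by rewrite -[RHS](mulKmx hA1) -xE mulmxDr mulKmx // mulmxA.
  have [x1 [x2 xE]] := surj (invmx A1 *m Y); exists (x1, x2).
  by rewrite /omega /= -[RHS](mulKVmx hA1) -xE mulmxDr !mulmxA mulmxV // mul1mx.
apply: (iff_trans omegaE); clearbody A; set r := \rank (kermx A).
split=> [surjA|lt_krn Y].
  (* The inequality is between integers: for [r = 0] its left side is negative. *)
  have [r_le0|r_gt0] := leqP r 0.
    move: r_le0; rewrite leqn0 => /eqP ->.
    by rewrite sub0r mulrN1 (@lt_trans _ _ 0) // oppr_lt0 ltz_nat.
  rewrite -(prednK r_gt0) -addn1 PoszD addrK -PoszM ltz_nat ltnS.
  by apply: waring_surj_bound surjA; rewrite -/r prednK.
(* The absence of chains is phrased as an inclusion of subspaces, so that its failure yields a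
   vector [w]. *)
have [chainY|] := boolP (kermx A :&: kermx (Y *m A) :&: kermx (Y *m Y) <=
  kermx Y)%MS.
  apply: waring_generic => // w wA wYA wYY; apply/sub_kermxP.
  apply: submx_trans chainY; rewrite !sub_capmx.
  by rewrite !(introT sub_kermxP) // mulmxA.
case/row_subPn => i; set w := row i _; rewrite sub_kermx => wY.
have : (w <= kermx A :&: kermx (Y *m A) :&: kermx (Y *m Y))%MS by apply:
  row_sub.
rewrite !sub_capmx => /andP[/andP[/sub_kermxP wA /sub_kermxP wYA] /sub_kermxP
  wYY].
rewrite !mulmxA in wYA wYY.
have r_gt1 : (1 < r)%N.
  have free : row_free (col_mx (w *m Y) w).
    by apply: (@row_free_col_mx _ _ _ _ _ _ _ Y); rewrite ?row_free_rV.
  rewrite -[2%N](eqP free); apply: mxrankS; apply/sub_kermxP.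
  by rewrite mul_col_mx wYA wA col_mx0.
have lt_krn' : (k * r.-1 <= n)%N.
  by move: lt_krn; rewrite -{1}(prednK (ltnW r_gt1)) -addn1 PoszD addrK -PoszM
    ltz_nat.
apply: (@waring_jordan_chain _ _ _ _ _ w) => //.
  rewrite k_gt0 (leq_trans _ lt_krn') // -[X in (X <= _)%N]muln1 leq_mul2l.
  by rewrite -ltnS prednK ?r_gt1 ?orbT // ltnW.
(* With [k >= 2], [r >= 3] would force 4 <= k (r - 1) <= n <= 3. *)
rewrite leqNgt; apply/negP => r_gt2; have : (2 * 2 <= k * r.-1)%N.
  by rewrite leq_mul // -ltnS prednK // ltnW.
by move=> /leq_trans/(_ (leq_trans lt_krn' le_n3)).
Qed.
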